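(* Let $a>1$ be an integer, let $p$ be a prime, let $K \ge 1$ be an integer, and let $N = 2Kp^2+1$. Suppose that $2K < p$ and $2K < \log_a(2Kp^2+1)$. If $a^{N-1} \equiv 1 \pmod N$, then $N$ is prime. *)

(* Defs.v *)
From mathcomp Require Import all_boot all_order all_algebra.
From mathcomp Require Import reals exp.

Set Implicit Arguments.
Unset Strict Implicit.
Unset Printing Implicit Defensive.

(* Only meaningful for 0 < x, 0 < b and b != 1, as [ln] and division are total. *)
Definition logb (R : realType) (b x : R) : R := (ln x / ln b)%R.

(* Main.v *)
(* Put b = a^(2K). The logarithmic hypothesis gives 1 < b < N, while
   b^(p^2) = 1 mod N; if p did not divide totient N, Euler's theorem would force
   b = 1 mod N. So p divides totient N, and since p does not divide N, some prime
   q | N satisfies q = 1 mod p. The cofactor is then also 1 mod p, and a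
   nontrivial factorization N = (1 + s p)(1 + t p) would give p | s + t and
   s t < 2K < p, which contradicts s + t <= s t + 1. *)
Require Import Defs.
From mathcomp Require Import all_boot all_order all_algebra.
From mathcomp Require Import cyclic reals exp zify.
Import Order.TTheory GRing.Theory Num.Theory.

Lemma expn_lt_logb (R : realType) (a k n : nat) : 1 < a -> 0 < n ->
  (k%:R < logb a%:R n%:R :> R)%R -> a ^ k < n.
Proof.
move=> a1 n0; rewrite /logb ltr_pdivlMr; last by rewrite ln_gt0 ?ltr1n.
have a0 : 0 < a by apply: ltnW.
rewrite mulr_natl -lnXn ?ltr0n// ltr_ln ?posrE ?exprn_gt0 ?ltr0n//.
by rewrite -natrX ltr_nat.
Qed.

(** Bezout over the naturals, where [0 < m] is used, gives [u * m = v * totient N + 1]; as exponents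
    of [b], the left side yields [1] and the right side, by Euler, [b]. *)
Lemma coprime_totient_exp_mod1 (N b m : nat) : 0 < m -> coprime b N ->
  coprime m (totient N) -> b ^ m = 1 %[mod N] -> b = 1 %[mod N].
Proof.
move=> m0 cbN cmt bm; case: (egcdnP (totient N) m0) => u v + _.
rewrite (eqP cmt) => uv.
have : b ^ (u * m) = b ^ (v * totient N + 1) %[mod N] by rewrite uv.
rewrite mulnC expnM -modnXm bm modnXm exp1n expnD expn1 => ->.
rewrite mulnC (mulnC v) expnM -modnMmr -modnXm (Euler_exp_totient cbN).
by rewrite modnXm exp1n modnMmr muln1.
Qed.

(** [totient N] is a product of factors [q.-1 * q ^ (e - 1)], with [e] the multiplicity of the prime
    [q] in [N]; if [p] divided the power of [q], then [p = q] would divide [N]. *)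
Lemma prime_dvd_totient (p N : nat) : prime p -> 0 < N -> ~~ (p %| N) ->
  p %| totient N -> exists q, [/\ prime q, q %| N & p %| q.-1].
Proof.
move=> pp N0 pN; rewrite totientE// big_seq Euclid_dvd_prod// big_has_cond.
case/hasP => q; rewrite mem_primes => /and3P[pq _ qN] /andP[_].
rewrite Euclid_dvdM// => /orP[pq1|]; first by exists q.
rewrite Euclid_dvdX// dvdn_prime2// => /andP[/eqP pqE _].
by rewrite pqE qN in pN.
Qed.

Lemma factors_mod1_bound (p s t c : nat) : 0 < s -> 0 < t -> c < p ->
  (s * p + 1) * (t * p + 1) <> c * p ^ 2 + 1.
Proof.
move=> s0 t0 cp E.
have p0 : 0 < p by apply: leq_trans cp.
have {}E : s * t * p + (s + t) = c * p.
  by apply/eqP; rewrite -(eqn_pmul2r p0); apply/eqP; lia.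
have stc : s * t < c by rewrite -(ltn_pmul2r p0); lia.
(* By [E], [s + t] is [(c - s * t) * p], a positive multiple of [p]. *)
have : p <= s + t by nia.
by nia.
Qed.

Theorem corollary3p2 (R : realType) (a p K N : nat) (ha : 1 < a)
    (hp : prime p) (hK : 1 <= K) (hN : N = 2 * K * p ^ 2 + 1)
    (hKp : 2 * K < p)
    (hlog : ((2 * K)%:R < logb a%:R (2 * K * p ^ 2 + 1)%:R :> R)%R)
    (hcong : a ^ (N - 1) = 1 %[mod N]) :
  prime N.
Proof.
have N0 : 0 < N by rewrite hN addn1.
have aN : a ^ (2 * K) < N.
  by rewrite hN; apply: (expn_lt_logb _ _ _ _ ha _ hlog); rewrite addn1.
have a1 : 1 < a ^ (2 * K) by rewrite -[X in X < _](exp1n (2 * K)) ltn_exp2r// muln_gt0.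
have N1 : 1 < N by apply: ltn_trans aN.
have N1E : N - 1 = 2 * K * p ^ 2 by rewrite hN addnK.
have caN : coprime a N.
  (* Being [1] mod [N], the power [a ^ (N - 1)] is coprime to [N], hence so is [a]. *)
  rewrite -(@coprime_pexpl (N - 1)) ?subn_gt0//.
  by rewrite -coprime_modl hcong coprime_modl coprime1n.
have pt : p %| totient N.
  apply: contraT => npt.
  have : a ^ (2 * K) = 1 %[mod N].
    apply: (@coprime_totient_exp_mod1 _ _ (p ^ 2)).
    - by rewrite expn_gt0 prime_gt0.
    - exact: coprimeXl.
    - by rewrite coprimeXl// prime_coprime.
    - by rewrite -expnM -N1E.
  (* Both sides are below [N], so the congruence is an equality. *)
  by rewrite !modn_small// => aE; rewrite aE in a1.
have pN : ~~ (p %| N).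
  by rewrite hN dvdn_addr ?dvdn_mull ?dvdn_exp// dvdn1 gtn_eqF ?prime_gt1.
have [q [pq /dvdnP[m Nmq] /dvdnP[s qs]]] := prime_dvd_totient _ _ hp N0 pN pt.
have q1 := prime_gt1 pq.
have qE : q = s * p + 1 by rewrite -qs addn1 prednK// ltnW.
have m0 : 0 < m by move: N0; rewrite Nmq muln_gt0 => /andP[].
have /dvdnP[t mt] : p %| m - 1.
  have : p %| N - 1 by rewrite N1E dvdn_mull// dvdn_exp.
  have -> : N - 1 = m * s * p + (m - 1) by rewrite Nmq qE mulnDr muln1 addnBA// mulnA.
  by rewrite dvdn_addr// dvdn_mull.
have mE : m = t * p + 1 by rewrite -mt subnK.
(* If [t = 0], the cofactor [m] is [1] and [N] is the prime [q]. *)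
have [t0|t0] := posnP t; first by rewrite Nmq mE t0 mul1n.
case: (factors_mod1_bound p s t (2 * K)) => //; last by rewrite -qE -mE mulnC -Nmq.
by move: q1; rewrite qE addn1 ltnS muln_gt0 => /andP[].
Qed.
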